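(* Let $G\le\mathrm{Sym}(\Gamma)$ and $H\le\mathrm{Sym}(\Delta)$ be transitive permutation groups on finite sets $\Gamma$ and $\Delta$. If the direct product $G\times H$ in its product action on $\Gamma\times\Delta$ is pre-primitive, then both $G$ and $H$ are pre-primitive.
   Context: The product action of $G\times H$ on $\Gamma\times\Delta$ is $(\gamma,\delta)(g,h)=(\gamma g,\delta h)$. A partition of $\Omega$ is $G$-invariant if every $g\in G$ maps each part onto a part. The orbit partition of a subgroup is the partition of $\Omega$ into its orbits. A transitive permutation group $G$ on a finite set $\Omega$ is pre-primitive if every $G$-invariant partition of $\Omega$ is the orbit partition of some subgroup of $G$. *)

(* Defs.v *)
From mathcomp Require Import all_boot all_fingroup.

Set Implicit Arguments.
Unset Strict Implicit.
Unset Printing Implicit Defensive.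

Local Open Scope group_scope.

Section PrePrimitive.

Variable T : finType.
Implicit Types (G K : {group {perm T}}) (P : {set {set T}}).

Definition invariant_partition G P : Prop :=
  partition P [set: T] /\ forall g, g \in G -> forall B, B \in P -> g @: B \in P.

Definition orbit_partition K : {set {set T}} := orbit 'P K @: [set: T].

(* [transitive _, on _ | _] is false for an action on the empty set, so
   a pre-primitive group acts on a nonempty set. *)
Definition pre_primitive G : Prop :=
  [transitive G, on [set: T] | 'P] /\
  forall P, invariant_partition G P ->
    exists2 K : {group {perm T}}, K \subset G & P = orbit_partition K.

End PrePrimitive.

Section ProductAction.

Variables (T1 T2 : finType).

Definition prod_act (x : T1 * T2) (u : {perm T1} * {perm T2}) : T1 * T2 :=
  (u.1 x.1, u.2 x.2).

Lemma prod_act1 : prod_act^~ 1 =1 id.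
Proof. by case=> a b; rewrite /prod_act !perm1. Qed.

Lemma prod_actM x : act_morph prod_act x.
Proof. by move=> u v; rewrite /prod_act !permM. Qed.

Canonical prod_action := TotalAction prod_act1 prod_actM.

(* The permutation group on T1 * T2 induced by G x H in its product action. *)
Definition prod_action_group (G : {group {perm T1}}) (H : {group {perm T2}}) :
    {group {perm T1 * T2}} :=
  (actperm prod_action @* setX G H)%G.

End ProductAction.

(* Main.v *)
Require Import Defs.
From mathcomp Require Import all_boot all_fingroup.

Set Implicit Arguments.
Unset Strict Implicit.
Unset Printing Implicit Defensive.

Local Open Scope group_scope.

(** Pre-primitivity passes to quotient actions, and each factor of a product
    action is a quotient of it, through the corresponding coordinate projection.

    Let [f : S -> T] be onto and let [L] act on [S] and [G] on [T] in such a way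
    that every element of [L] induces an element of [G] through [f].  The inverse
    images under [f] of the parts of a [G]-invariant partition [P] of [T] form an
    [L]-invariant partition of [S] ([pullback_invariant]), which is therefore the
    orbit partition of some [K] contained in [L].  The group [induced f G K] of
    the elements of [G] induced by elements of [K] has the images of the
    [K]-orbits as its orbits ([orbit_induced]).  Since [f] is onto, these images
    are exactly the parts of [P], so [P] is the orbit partition of a subgroup of
    [G] ([pre_primitive_quotient]). *)

Section Quotient.

Variables (S T : finType) (f : S -> T).
Implicit Types (G : {group {perm T}}) (K L : {group {perm S}}).
Implicit Types (P : {set {set T}}).

Definition lifts (k : {perm S}) (g : {perm T}) :=
  [forall s, f (k s) == g (f s)].

Lemma liftsP (k : {perm S}) (g : {perm T}) :
  reflect (forall s, f (k s) = g (f s)) (lifts k g).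
Proof. by apply: (iffP forallP) => fkg s; apply/eqP. Qed.

Definition induced G K := [set g in G | [exists k in K, lifts k g]].

Lemma group_set_induced G K : group_set (induced G K).
Proof.
apply/group_setP; split=> [|g h]; rewrite !inE.
  rewrite group1; apply/exists_inP; exists 1 => //.
  by apply/liftsP=> s; rewrite !perm1.
move=> /andP[Gg /exists_inP[k Kk /liftsP fkg]].
move=> /andP[Gh /exists_inP[l Kl /liftsP flh]].
rewrite groupM //; apply/exists_inP; exists (k * l); first exact: groupM.
by apply/liftsP=> s; rewrite !permM flh fkg.
Qed.

Canonical induced_group G K := Group (group_set_induced G K).

(** An element of [induced f G K] moves [f s] to [f (k s)] for some [k] in [K];
    conversely each [k] in [K] induces some element, which realizes the move from
    [f s] to [f (k s)]. *)
Lemma orbit_induced G K :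
    (forall k, k \in K -> exists2 g, g \in G & lifts k g) ->
  forall s, orbit 'P (induced G K) (f s) = f @: orbit 'P K s.
Proof.
move=> indK s; apply/setP=> y; apply/orbitP/imsetP.
  case=> g; rewrite inE => /andP[_ /exists_inP[k Kk /liftsP fkg]] <-.
  by exists (k s); [exact: mem_orbit | rewrite fkg].
case=> _ /orbitP[k Kk <-] ->; have [g Gg fkg] := indK k Kk.
exists g; last by rewrite /= !apermE (liftsP _ _ fkg).
by rewrite inE Gg; apply/exists_inP; exists k.
Qed.

Definition pullback P : {set {set S}} := [set f @^-1: B | B : {set T} in P].

Hypothesis f_onto : forall y, exists s, f s = y.

Lemma imset_preimset_onto (B : {set T}) : f @: (f @^-1: B) = B.
Proof.
apply/setP=> y; apply/imsetP/idP=> [[s] | By]; first by rewrite inE => ? ->.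
by have [s fs] := f_onto y; exists s; rewrite ?inE fs.
Qed.

Lemma pullback_partition P :
  partition P [set: T] -> partition (pullback P) [set: S].
Proof.
case/and3P=> /eqP covP /trivIsetP trivP P0; apply/and3P; split.
- apply/eqP/setP=> s; rewrite inE; apply/bigcupP.
  have /bigcupP[B PB Bfs]: f s \in cover P by rewrite covP inE.
  by exists (f @^-1: B); rewrite ?inE ?imset_f.
- apply/trivIsetP=> _ _ /imsetP[B PB ->] /imsetP[C PC ->] neqBC.
  have neq : B != C by apply: contraNneq neqBC => ->.
  by rewrite -setI_eq0 -preimsetI (disjoint_setI0 (trivP _ _ PB PC neq)) preimset0.
- apply/imsetP=> -[B PB B0]; case/negP: P0.
  by rewrite -(imset0 f) B0 imset_preimset_onto.
Qed.

(** One inclusion of [k @: (f @^-1: B)] in [f @^-1: (g @: B)] is the lifting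
    relation; the other one cancels the injection [g]. *)
Lemma preimset_lifts (k : {perm S}) (g : {perm T}) (B : {set T}) :
  lifts k g -> k @: (f @^-1: B) = f @^-1: (g @: B).
Proof.
move/liftsP=> fkg; apply/setP=> s; rewrite inE; apply/imsetP/idP.
  by case=> r; rewrite inE => Br ->; rewrite fkg imset_f.
case/imsetP=> y By fsy; exists (k^-1 s); last by rewrite permKV.
by rewrite inE; suff -> : f (k^-1 s) = y by []; apply: (@perm_inj _ g);
   rewrite -fkg permKV.
Qed.

Lemma pullback_invariant G L P :
    (forall k, k \in L -> exists2 g, g \in G & lifts k g) ->
  invariant_partition G P -> invariant_partition L (pullback P).
Proof.
move=> indL [partP invP]; split=> [|k Lk _ /imsetP[B PB ->]].
  exact: pullback_partition.
have [g Gg /preimset_lifts->] := indL k Lk.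
by apply: imset_f; apply: invP.
Qed.

Lemma imset_onto : f @: [set: S] = [set: T].
Proof. by rewrite -(preimsetT f) imset_preimset_onto. Qed.

Lemma imset_orbit_partition G K :
    (forall k, k \in K -> exists2 g, g \in G & lifts k g) ->
  [set f @: C | C : {set S} in Defs.orbit_partition K]
    = Defs.orbit_partition (induced_group G K).
Proof.
move=> indK; rewrite /Defs.orbit_partition -imset_onto -!imset_comp.
by apply: eq_imset => s /=; rewrite orbit_induced.
Qed.

Theorem pre_primitive_quotient G L :
    (forall k, k \in L -> exists2 g, g \in G & lifts k g) ->
  pre_primitive L -> pre_primitive G.
Proof.
move=> indL [transL preL]; split=> [|P invP].
  have /imsetP[s _ orbLs] := transL.
  apply/imsetP; exists (f s); rewrite ?inE //; apply/esym/eqP.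
  rewrite eqEsubset subsetT -imset_onto orbLs -(orbit_induced indL).
  by apply: imsetS; apply/subsetP=> g; rewrite inE => /andP[].
have [K sKL pullE] := preL _ (pullback_invariant indL invP).
exists (induced_group G K).
  by apply/subsetP=> g; rewrite inE => /andP[].
rewrite -imset_orbit_partition => [|k Kk]; last exact/indL/(subsetP sKL).
rewrite -pullE -imset_comp -[LHS]imset_id.
by apply: eq_imset => B /=; rewrite imset_preimset_onto.
Qed.

End Quotient.

Lemma prod_action_groupP (T1 T2 : finType)
    (G : {group {perm T1}}) (H : {group {perm T2}}) k :
    k \in prod_action_group G H ->
  exists g h, [/\ g \in G, h \in H & forall x, k x = (g x.1, h x.2)].
Proof.
case/morphimP=> -[g h] _ /setXP[Gg Hh] ->; exists g, h; split=> // x.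
by rewrite actpermE.
Qed.

Theorem theorem2p14 (Gamma Delta : finType)
    (G : {group {perm Gamma}}) (H : {group {perm Delta}})
    (transG : [transitive G, on [set: Gamma] | 'P])
    (transH : [transitive H, on [set: Delta] | 'P]) :
  pre_primitive (prod_action_group G H) -> pre_primitive G /\ pre_primitive H.
Proof.
move=> preGH.
(* A transitive action has a point, so both projections are onto. *)
have [/imsetP[a _ _] /imsetP[b _ _]] := (transG, transH).
split.
- apply: (@pre_primitive_quotient _ _ fst) preGH => [x | k].
    by exists (x, b).
  case/prod_action_groupP=> g [h [Gg _ kE]]; exists g => //.
  by apply/liftsP=> x; rewrite kE.
- apply: (@pre_primitive_quotient _ _ snd) preGH => [y | k].
    by exists (a, y).
  case/prod_action_groupP=> g [h [_ Hh kE]]; exists h => //.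
  by apply/liftsP=> x; rewrite kE.
Qed.
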